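(* Let $\mathcal{P}$ be a finite 2-dimensional poset and let $L,\overline{L}$ be a diametral pair of linear extensions of the downset lattice $\mathcal{D}_\mathcal{P}$. Let $\sigma$ be the linear extension of $\mathcal{P}$ given by the order in which the principal downsets $x^{\downarrow}$, $x\in\mathcal{P}$, appear in $L$. Then $\sigma$ belongs to a diametral pair $\sigma,\overline{\sigma}$ of linear extensions of $\mathcal{P}$, and $L=L_\sigma$ and $\overline{L}=L_{\overline{\sigma}}$.
   Context: $\mathcal{P}$ is 2-dimensional if it has a realizer $\{L_1,L_2\}$: two linear extensions whose common comparabilities are exactly those of $\mathcal{P}$. $\mathcal{D}_\mathcal{P}$ is the poset of downsets of $\mathcal{P}$ ordered by inclusion. For a linear extension $\sigma$ of $\mathcal{P}$, $L_\sigma$ is the linear order on downsets with $A^{\downarrow}<B^{\downarrow}$ iff $\max_\sigma(A\triangle B)\in B$, where $A,B$ are the antichains of maximal elements and $\max_\sigma S$ is the $\sigma$-largest element of $S$. The distance between two linear extensions is the number of unordered pairs appearing in different orders in them; a diametral pair is a pair of linear extensions of maximum distance. *)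

(* Defs.v *)
From HB Require Import structures.
From mathcomp Require Import all_boot all_order.

Set Implicit Arguments.
Unset Strict Implicit.
Unset Printing Implicit Defensive.

Import Order.TTheory.
Local Open Scope order_scope.

(* Linear orders on a finite type are represented by their reflexive relation,
   so two of them are the same when they are equal pointwise (=2). *)
Definition linear_order (T : finType) (L : rel T) : Prop :=
  [/\ reflexive L, antisymmetric L, transitive L & total L].

Definition linear_extension (d : Order.disp_t) (P : finPOrderType d)
    (L : rel P) : Prop :=
  linear_order L /\ (forall x y : P, x <= y -> L x y).

(* L1 and L2 may coincide, so this reads "dimension at most 2"; the only posets
   it adds to those of dimension exactly 2 are the chains. *)
Definition two_dimensional (d : Order.disp_t) (P : finPOrderType d) : Prop :=
  exists L1 L2 : rel P,
    [/\ linear_extension L1, linear_extension L2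
      & forall x y : P, x <= y <-> L1 x y /\ L2 x y].

Definition distance (T : finType) (L1 L2 : rel T) : nat :=
  #|[set e : {set T} | [exists x, exists y,
       [&& e == [set x; y], x != y, L1 x y & L2 y x]]]|.

Definition diametral_pair (d : Order.disp_t) (P : finPOrderType d)
    (L1 L2 : rel P) : Prop :=
  [/\ linear_extension L1, linear_extension L2
    & forall M1 M2 : rel P, linear_extension M1 -> linear_extension M2 ->
        (distance M1 M2 <= distance L1 L2)%N].

Definition is_downset (d : Order.disp_t) (P : finPOrderType d)
    (A : {set P}) : bool :=
  [forall x in A, forall y, (y <= x) ==> (y \in A)].

Record downset (d : Order.disp_t) (P : finPOrderType d) := Downset {
  downset_set :> {set P};
  downsetP : is_downset downset_set
}.

HB.instance Definition _ (d : Order.disp_t) (P : finPOrderType d) :=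
  [isSub for @downset_set d P].
HB.instance Definition _ (d : Order.disp_t) (P : finPOrderType d) :=
  [Finite of downset P by <:].

Definition downset_le (d : Order.disp_t) (P : finPOrderType d) :
  rel (downset P) := fun A B => (A : {set P}) \subset B.

Lemma downset_le_refl (d : Order.disp_t) (P : finPOrderType d) :
  reflexive (@downset_le d P).
Proof. by move=> A; apply: subxx. Qed.

Lemma downset_le_anti (d : Order.disp_t) (P : finPOrderType d) :
  antisymmetric (@downset_le d P).
Proof. by move=> A B sAB; apply: val_inj; apply/eqP; rewrite eqEsubset. Qed.

Lemma downset_le_trans (d : Order.disp_t) (P : finPOrderType d) :
  transitive (@downset_le d P).
Proof. by move=> B A C; apply: subset_trans. Qed.

HB.instance Definition _ (d : Order.disp_t) (P : finPOrderType d) :=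
  Order.Le_isPOrder.Build Order.SetSubsetOrder.subset_display (downset P)
    (@downset_le_refl d P) (@downset_le_anti d P) (@downset_le_trans d P).

Lemma principal_subproof (d : Order.disp_t) (P : finPOrderType d) (x : P) :
  is_downset [set y | y <= x].
Proof.
apply/forall_inP => y; rewrite inE => le_yx.
by apply/forallP => z; apply/implyP => le_zy; rewrite inE (le_trans le_zy).
Qed.

Definition principal (d : Order.disp_t) (P : finPOrderType d) (x : P) :
  downset P := Downset (principal_subproof x).

Definition maximal_elements (d : Order.disp_t) (P : finPOrderType d)
    (D : {set P}) : {set P} :=
  [set x in D | [forall y in D, (x <= y) ==> (y == x)]].

Definition symdiff (T : finType) (A B : {set T}) : {set T} :=
  (A :\: B) :|: (B :\: A).

Definition max_elt (T : finType) (s : rel T) (S : {set T}) : option T :=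
  [pick m in S | [forall z in S, s z m]].

Definition L_of (d : Order.disp_t) (P : finPOrderType d) (s : rel P) :
  rel (downset P) := fun D E =>
  let A := maximal_elements D in
  let B := maximal_elements E in
  (D == E) || (if max_elt s (symdiff A B) is Some m then m \in B else false).

Definition principal_order (d : Order.disp_t) (P : finPOrderType d)
    (L : rel (downset P)) : rel P :=
  fun x y => L (principal x) (principal y).

(* Main.v *)
Require Import Defs.
From mathcomp Require Import all_boot all_order.
From mathcomp Require Import zify.

(** Pairs of downsets (D, E) with D :&: E = I and D :|: E = U correspond to
    splittings of U :\: I into two unions of connected components. In such a
    block, a linear extension of the downset lattice selects, as the pairs whose
    second entry is the larger one, one half of the pairs, closed under
    shrinking the first entry and enlarging the second. By Daykin's inequality
    two linear extensions therefore agree on at least a quarter of the block,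
    that is, they reverse at most a quarter of it. For a realizer s1, s2 of P,
    the maxima of U :\: I in s1 and s2 lie in different components whenever
    U :\: I is disconnected, and L_s1 and L_s2 agree exactly on the pairs whose
    second entry contains both maxima, so they attain the bound. Hence a
    diametral pair L1, L2 attains it in every such block: if it agrees on all
    pairs whose second entry contains two given elements of different
    components, it agrees on no other pair.

    For the block of two incomparable principal downsets this shows that the
    orders s1, s2 in which the principal downsets appear in L1, L2 form a
    realizer. That L1 contains L_s1 follows by induction on |D| + |E|: deleting
    a maximal element other than the s1-maximum of the symmetric difference from
    the larger of D and E gives a smaller pair, so that in a minimal
    counterexample D and E are principal, and these are ordered as s1
    prescribes. *)

Set Implicit Arguments.
Unset Strict Implicit.
Unset Printing Implicit Defensive.

Import Order.TTheory.

(** * The four functions theorem *)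

Lemma big_subsetD1 (R : Type) (idx : R) (op : Monoid.com_law idx) (T : finType)
    (S : {set T}) (x : T) (F : {set T} -> R) : x \in S ->
  \big[op/idx]_(A : {set T} | A \subset S) F A =
  op (\big[op/idx]_(A : {set T} | A \subset S :\ x) F A)
     (\big[op/idx]_(A : {set T} | A \subset S :\ x) F (x |: A)).
Proof.
move=> Sx; rewrite (bigID (fun A : {set T} => x \notin A)) /=; congr (op _ _).
  by apply: eq_bigl => A; rewrite subsetD1.
rewrite (reindex_onto (fun A : {set T} => x |: A) (fun A => A :\ x)) /= => [|A].
  apply: eq_bigl => A; rewrite negbK setU11 andbT subUset sub1set Sx subsetD1 /=.
  by congr (_ && _); apply/eqP/idP => [<- | /setU1K//]; rewrite setD11.
by rewrite negbK => /andP[_ /setD1K].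
Qed.

(* With u = a0 * b1, v = a1 * b0, w = c1 * d0 and z = c0 * d1, the bounds
   u, v <= w and u * v <= w * z yield u + v <= w + z, since
   (w - u) * (w - v) >= 0. *)
Lemma four_functions_nat (a0 a1 b0 b1 c0 c1 d0 d1 : nat) :
    a0 * b0 <= c0 * d0 -> a0 * b1 <= c1 * d0 -> a1 * b0 <= c1 * d0 ->
    a1 * b1 <= c1 * d1 ->
  (a0 + a1) * (b0 + b1) <= (c0 + c1) * (d0 + d1).
Proof.
move=> le00 le01 le10 le11.
suff: a0 * b1 + a1 * b0 <= c1 * d0 + c0 * d1 by nia.
have le_prod : (a0 * b1) * (a1 * b0) <= (c1 * d0) * (c0 * d1).
  by have := leq_mul le00 le11; nia.
move: (a0 * b1) (a1 * b0) (c1 * d0) (c0 * d1) le01 le10 le_prod => u v w z; nia.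
Qed.

Theorem four_functions (T : finType) (alpha beta gamma delta : {set T} -> nat)
    (S : {set T}) :
    (forall A B : {set T}, A \subset S -> B \subset S ->
       alpha A * beta B <= gamma (A :|: B) * delta (A :&: B)) ->
  (\sum_(A : {set T} | A \subset S) alpha A) *
  (\sum_(A : {set T} | A \subset S) beta A)
  <= (\sum_(A : {set T} | A \subset S) gamma A) *
     (\sum_(A : {set T} | A \subset S) delta A).
Proof.
have [n] := ubnP #|S|.
elim: n S alpha beta gamma delta => // n IHn S alpha beta gamma delta ltSn le4.
have [eqS0 | [x Sx]] := set_0Vmem S.
  rewrite !(big_pred1 set0); try by move=> A; rewrite eqS0 subset0.
  by have := le4 set0 set0; rewrite !sub0set setU0 setI0; apply.
rewrite !(big_subsetD1 _ _ Sx) -!big_split /=; apply: IHn.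
  by move: ltSn; rewrite (cardsD1 x) Sx.
move=> A B /subsetD1P[sAS xA] /subsetD1P[sBS xB].
have sub_xS (C : {set T}) : C \subset S -> x |: C \subset S.
  by rewrite subUset sub1set Sx.
have eq01 : A :&: (x |: B) = A :&: B.
  by rewrite setIUr (disjoint_setI0 _) ?set0U // disjoint_sym disjoints1.
have eq10 : (x |: A) :&: B = A :&: B.
  by rewrite setIUl (disjoint_setI0 _) ?set0U // disjoints1.
apply: four_functions_nat.
- exact: le4.
- by rewrite -eq01 setUCA; apply: le4; rewrite ?sub_xS.
- by rewrite -eq10 setUA; apply: le4; rewrite ?sub_xS.
by rewrite setUIr setUUr; apply: le4; apply: sub_xS.
Qed.

Corollary daykin_inequality (T : finType) (F G : {set {set T}}) :
  #|F| * #|G| <=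
  #|[set A :|: B | A in F, B in G]| * #|[set A :&: B | A in F, B in G]|.
Proof.
have card_sum (H : {set {set T}}) :
    #|H| = \sum_(A : {set T} | A \subset setT) (A \in H).
  rewrite -sum1_card big_mkcond /=.
  apply: eq_big => A; first by rewrite subsetT.
  by case: (A \in H).
rewrite !card_sum; apply: four_functions => A B _ _.
have [FA | //] := boolP (A \in F); have [GB | _] := boolP (B \in G).
  by rewrite !imset2_f.
by rewrite muln0.
Qed.

Lemma card_involution_half (T : finType) (A B : {set T}) (f : T -> T) :
    {in A, forall x, f x \in A} -> {in A, forall x, f (f x) = x} ->
    {in A, forall x, (f x \in B) = (x \notin B)} ->
  #|A :&: B| * 2 = #|A|.
Proof.
move=> fA fK fB; rewrite -[RHS](cardsID B) muln2 -addnn; congr addn.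
have injf : {in A :&: B &, injective f}.
  by move=> x y /setIP[Ax _] /setIP[Ay _] eq_f; rewrite -(fK x Ax) eq_f fK.
rewrite -(card_in_imset injf); apply: eq_card => y.
apply/imsetP/setDP => [[x /setIP[Ax Bx] ->] | [Ay By]].
  by rewrite fA ?fB ?Bx.
by exists (f y); rewrite ?fK // inE fA ?fB.
Qed.

(** * The colexicographic order *)

Section SymmetricDifference.
Variable T : finType.
Implicit Types A B : {set T}.

Lemma in_symdiff A B x : (x \in symdiff A B) = (x \in A) (+) (x \in B).
Proof. by rewrite !inE; do 2!case: (x \in _). Qed.

Lemma symdiffC A B : symdiff A B = symdiff B A.
Proof. exact: setUC. Qed.

Lemma symdiff_eq0 A B : (symdiff A B == set0) = (A == B).
Proof. by rewrite setU_eq0 !setD_eq0 eqEsubset. Qed.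

End SymmetricDifference.

Section LinearOrder.
Variables (T : finType) (s : rel T).
Implicit Types (x y m : T) (A B C : {set T}).

Definition is_max A m := (m \in A) && [forall z in A, s z m].

Lemma is_maxP A m :
  reflect (m \in A /\ forall z, z \in A -> s z m) (is_max A m).
Proof. by apply: (iffP andP) => -[Am /forall_inP]. Qed.

Lemma is_max_subset A B m : A \subset B -> m \in A -> is_max B m -> is_max A m.
Proof.
by move=> /subsetP sAB Am /is_maxP[_ max_m]; apply/is_maxP; split=> // z /sAB/max_m.
Qed.

Lemma symdiff_max_mem A B m :
  is_max (symdiff A B) m -> (m \in A) = (m \notin B).
Proof. by case/is_maxP; rewrite in_symdiff => + _; do 2!case: (m \in _). Qed.

Definition colex : rel {set T} := fun A B =>
  (A == B) || (if max_elt s (symdiff A B) is Some m then m \in B else false).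

Definition graph : {set T * T} := [set p | s p.1 p.2].

Hypothesis lin_s : linear_order s.

Lemma linear_refl x : s x x. Proof. by case: lin_s. Qed.

Lemma linear_trans y x z : s x y -> s y z -> s x z.
Proof. by case: lin_s => _ _ trans_s _; apply: trans_s. Qed.

Lemma linear_anti x y : s x y -> s y x -> x = y.
Proof. by case: lin_s => _ anti_s _ _ sxy syx; apply: anti_s; rewrite sxy. Qed.

Lemma linear_total x y : s x y || s y x. Proof. by case: lin_s. Qed.

Lemma linear_neq x y : x != y -> s x y = ~~ s y x.
Proof.
move=> neq_xy; apply/idP/idP => [sxy | /negPf nsyx].
  by apply: contra neq_xy => /(linear_anti sxy)/eqP.
by have := linear_total x y; rewrite nsyx orbF.
Qed.

Lemma linearN x y : ~~ s x y -> s y x.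
Proof. by move=> /negPf nsxy; have := linear_total x y; rewrite nsxy. Qed.

Lemma exists_max A : A != set0 -> exists m, is_max A m.
Proof.
case/set0Pn => x Ax; have [refl_s _ trans_s total_s] := lin_s.
case: (@extremumP _ _ (fun y z => s z y) x [in A] id) => [//|||//|m Am max_m].
- by move=> y z w szy swz; apply: trans_s swz szy.
- by move=> y z; apply: total_s.
by exists m; apply/is_maxP.
Qed.

Lemma max_elt_is_max A m : is_max A m -> max_elt s A = Some m.
Proof.
move=> max_m; rewrite /max_elt; case: pickP => [m' max_m' | /(_ m)]; last first.
  by rewrite -/(is_max A m) max_m.
have [[Am le_m] [Am' le_m']] := (is_maxP _ _ max_m, is_maxP _ _ max_m').
by congr Some; apply: linear_anti; [apply: le_m | apply: le_m'].
Qed.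

Lemma colex_max A B m : is_max (symdiff A B) m -> colex A B = (m \in B).
Proof.
move=> max_m; rewrite /colex (max_elt_is_max max_m) -symdiff_eq0.
by case: eqP max_m => //= ->; rewrite /is_max inE.
Qed.

Lemma subset_colex A B : A \subset B -> colex A B.
Proof.
move=> /subsetP sAB; have [-> | ] := eqVneq A B; first by rewrite /colex eqxx.
rewrite -symdiff_eq0 => /exists_max[m max_m]; rewrite (colex_max max_m).
apply: contraT => nBm; case/negP: (nBm).
by apply: sAB; rewrite (symdiff_max_mem max_m).
Qed.

Lemma colex_neq A B : A != B -> colex A B = ~~ colex B A.
Proof.
rewrite -symdiff_eq0 => /exists_max[m max_m].
rewrite (colex_max max_m) -[m \in B]negbK -(symdiff_max_mem max_m).
by rewrite symdiffC in max_m; rewrite (colex_max max_m).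
Qed.

Lemma colex_linear : linear_order colex.
Proof.
split.
- by move=> A; rewrite /colex eqxx.
- move=> A B /andP[leAB leBA]; apply/eqP; apply: contraLR leAB => /colex_neq->.
  by rewrite leBA.
- move=> B A C leAB leBC; have [-> // | neAB] := eqVneq A B.
  pose W := symdiff A B :|: symdiff B C.
  have [m max_m] : exists m, is_max W m.
    by apply: exists_max; rewrite setU_eq0 !symdiff_eq0 (negPf neAB).
  have [Wm _] := is_maxP _ _ max_m.
  have max_sub X Y : symdiff X Y \subset W -> colex X Y ->
      m \in symdiff X Y -> m \in Y.
    by move=> sW leXY XYm; rewrite -(colex_max (is_max_subset sW XYm max_m)).
  have := max_sub _ _ (subsetUl _ _) leAB; have := max_sub _ _ (subsetUr _ _) leBC.
  have sAC : symdiff A C \subset W.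
    apply/subsetP => z; rewrite /W in_symdiff in_setU !in_symdiff.
    by do 3!case: (z \in _).
  move=> BCm ABm; have [ACm Cm] : m \in symdiff A C /\ m \in C.
    move: Wm BCm ABm; rewrite /W in_setU !in_symdiff.
    case: (m \in A); case: (m \in B); case: (m \in C) => //= _ BC AB;
      by split; auto.
  by rewrite (colex_max (is_max_subset sAC ACm max_m)).
move=> A B; have [-> | /colex_neq->] := eqVneq A B; first by rewrite /colex eqxx.
by rewrite orNb.
Qed.

End LinearOrder.

Lemma linear_subrel_eq (T : finType) (s t : rel T) :
  linear_order s -> linear_order t -> subrel s t -> s =2 t.
Proof.
move=> lin_s lin_t sub_st x y; have [-> | neq_xy] := eqVneq x y.
  by rewrite (linear_refl lin_s) (linear_refl lin_t).
apply/idP/idP => [/sub_st // | ]; rewrite (linear_neq lin_t neq_xy).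
by apply: contraR => /(linearN lin_s)/sub_st.
Qed.

Lemma distance_graph (T : finType) (s t : rel T) :
  linear_order s -> linear_order t -> distance s t = #|graph s :\: graph t|.
Proof.
move=> lin_s lin_t; rewrite /distance.
have in_diff x y : ((x, y) \in graph s :\: graph t) = [&& x != y, s x y & t y x].
  rewrite !inE /=; have [-> | neq_xy] := eqVneq x y.
    by rewrite (linear_refl lin_t).
  by rewrite (linear_neq lin_t neq_xy) negbK andbC.
have inj_pair : {in graph s :\: graph t &, injective (fun p => [set p.1; p.2])}.
  move=> [x y] [x' y']; rewrite !in_diff.
  move=> /and3P[neq_xy sxy _] /and3P[_ sxy' _] eq_e.
  have: x \in [set x'; y'] by rewrite -eq_e set21.
  have: y \in [set x'; y'] by rewrite -eq_e set22.
  rewrite !inE => /orP[] /eqP ey /orP[] /eqP ex; subst;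
    rewrite ?eqxx // in neq_xy *.
  by rewrite (linear_anti lin_s sxy sxy') eqxx in neq_xy.
rewrite -(card_in_imset inj_pair); apply: eq_card => e; rewrite inE.
apply/existsP/imsetP => [[x /existsP[y /andP[/eqP-> rev_xy]]] | [[x y] rev_xy ->]].
  by exists (x, y); rewrite ?in_diff.
by exists x; apply/existsP; exists y; rewrite eqxx -in_diff.
Qed.

(** * Downsets *)

Local Open Scope order_scope.

Lemma incomparableE (d : Order.disp_t) (T : porderType d) (x y : T) :
  (x >< y) = ~~ (x <= y) && ~~ (y <= x).
Proof. exact: negb_or. Qed.

Section Downsets.
Variables (d : Order.disp_t) (P : finPOrderType d).
Implicit Types (D E : downset P) (A : {set P}) (x y z m : P).

Lemma is_downsetP A :
  reflect (forall x y, y <= x -> x \in A -> y \in A) (is_downset A).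
Proof.
apply: (iffP forall_inP) => [dA x y yx Ax | dA x Ax].
  by have /forallP/(_ y)/implyP/(_ yx) := dA x Ax.
by apply/forallP => y; apply/implyP => yx; apply: dA Ax.
Qed.

Lemma downset_closed D x y : y <= x -> x \in D -> y \in D.
Proof. by move: x y; apply/is_downsetP/downsetP. Qed.

Lemma downsetI_subproof D E : is_downset (D :&: E).
Proof.
apply/is_downsetP => x y yx /setIP[Dx Ex].
by rewrite inE !(downset_closed yx).
Qed.
Definition downsetI D E := Downset (downsetI_subproof D E).

Lemma downsetU_subproof D E : is_downset (D :|: E).
Proof.
apply/is_downsetP => x y yx; rewrite !inE.
by case/orP=> /(downset_closed yx)->; rewrite ?orbT.
Qed.
Definition downsetU D E := Downset (downsetU_subproof D E).

Lemma is_downset_initial (s : rel P) x :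
  linear_extension s -> is_downset [set y | s y x].
Proof.
case=> lin_s ext_s; apply/is_downsetP => y z zy; rewrite !inE.
exact/(linear_trans lin_s)/ext_s.
Qed.

Lemma principal_subset D x : x \in D -> principal x <= D.
Proof.
by move=> Dx; apply/subsetP => y; rewrite inE => /downset_closed; apply.
Qed.

Lemma incomparable_setD D E : D >< E -> exists x, x \in D :\: E.
Proof.
by move/incomparable_leF/negbT/subsetPn => [x Dx Ex]; exists x; rewrite inE Ex.
Qed.

Lemma setD_incomparable D E x y : x \in D :\: E -> y \in E :\: D -> x >< y.
Proof.
move=> /setDP[Dx nEx] /setDP[Ey nDy]; rewrite incomparableE.
by rewrite (contra _ nEx) ?(contra _ nDy) // => /downset_closed; apply.
Qed.

Lemma maximal_elements_subset D : maximal_elements D \subset D.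
Proof. by apply/subsetP => x; rewrite inE => /andP[]. Qed.

Lemma maximal_eq D x y : x \in maximal_elements D -> y \in D -> x <= y -> y = x.
Proof.
by rewrite inE => /andP[_ /forall_inP max_x] /max_x/implyP le_eq /le_eq/eqP.
Qed.

Lemma maximal_incomparable D x y :
  x \in maximal_elements D -> y \in maximal_elements D -> x != y -> x >< y.
Proof.
move=> Mx My neq_xy; have /subsetP sMD := maximal_elements_subset D.
rewrite incomparableE; apply/andP; split; apply: contra neq_xy => le_xy.
  by rewrite (maximal_eq Mx (sMD _ My) le_xy).
by rewrite (maximal_eq My (sMD _ Mx) le_xy).
Qed.

Lemma exists_maximal D x : x \in D -> exists2 y, y \in maximal_elements D & x <= y.
Proof.
move=> Dx; pose above_x y := (y \in D) && (x <= y).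
have Qx : above_x x by rewrite /above_x Dx lexx.
case: (arg_maxnP (fun y => #|[set z | z <= y]|) Qx) => y /andP[Dy xy] max_y.
exists y => //; rewrite inE Dy; apply/forall_inP => z Dz; apply/implyP => yz.
have := max_y z; rewrite /above_x Dz (le_trans xy yz) => /(_ isT).
apply: contraTT => neq_zy.
rewrite -ltnNge; apply/proper_card/properP; split.
  by apply/subsetP => w; rewrite !inE => /le_trans; apply.
by exists z; rewrite inE // lt_geF // lt_neqAle eq_sym neq_zy.
Qed.

Lemma is_downsetD1 D z : z \in maximal_elements D -> is_downset (D :\ z).
Proof.
move=> Mz; apply/is_downsetP => x y yx /setD1P[neq_xz Dx].
rewrite !inE (downset_closed yx Dx) andbT; apply: contra neq_xz => /eqP eq_yz.
by rewrite (maximal_eq Mz Dx) // -eq_yz.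
Qed.

End Downsets.

(** * The orders L_s *)

Section LOf.
Variables (d : Order.disp_t) (P : finPOrderType d) (s : rel P).
Hypothesis lext_s : linear_extension s.
Implicit Types (D E : downset P) (m : P).

Let lin_s : linear_order s := lext_s.1.
Let ext_s : forall x y, x <= y -> s x y := lext_s.2.

Lemma symdiff_max_maximal D E m :
  is_max s (symdiff D E) m -> m \in E -> m \in maximal_elements E.
Proof.
move=> max_m Em; have nDm : m \notin D by rewrite (symdiff_max_mem max_m) Em.
have [_ le_m] := is_maxP _ _ _ max_m; rewrite inE Em.
apply/forall_inP => z Ez; apply/implyP => le_mz.
apply/eqP/(linear_anti lin_s); last exact: ext_s.
apply: le_m; rewrite in_symdiff Ez addbT (contra _ nDm) //.
exact: downset_closed.
Qed.

Lemma mem_maximal_symdiff_max D E m :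
  is_max s (symdiff D E) m -> (m \in maximal_elements E) = (m \in E).
Proof.
move=> max_m; apply/idP/idP => [|/(symdiff_max_maximal max_m)//].
exact/subsetP/maximal_elements_subset.
Qed.

Lemma is_max_symdiff_maximal D E m : is_max s (symdiff D E) m ->
  is_max s (symdiff (maximal_elements D) (maximal_elements E)) m.
Proof.
move=> max_m; have [DEm le_m] := is_maxP _ _ _ max_m; apply/is_maxP; split.
  rewrite in_symdiff (mem_maximal_symdiff_max max_m); rewrite symdiffC in max_m.
  by rewrite (mem_maximal_symdiff_max max_m) -in_symdiff.
suff below (X Y : downset P) z : symdiff X Y = symdiff D E ->
    z \in maximal_elements X -> z \notin maximal_elements Y -> s z m.
  move=> z /setUP[]; rewrite in_setD => /andP[nMz Mz].
    exact: below Mz nMz.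
  by apply: below Mz nMz; rewrite symdiffC.
move=> eqDE Mz nMz; have Xz := subsetP (maximal_elements_subset X) z Mz.
have [Yz | Yz] := boolP (z \in Y); last by rewrite le_m // -eqDE in_symdiff Xz.
have [y My le_zy] := exists_maximal Yz.
apply: (linear_trans lin_s (ext_s le_zy)); apply: le_m.
rewrite -eqDE in_symdiff (subsetP (maximal_elements_subset Y)) // addbT.
by apply: contra nMz => Xy; rewrite -(maximal_eq Mz Xy le_zy).
Qed.

Lemma L_of_max D E m :
  is_max s (symdiff D E) m -> L_of s D E = (m \in E).
Proof.
move=> max_m; rewrite /L_of (max_elt_is_max lin_s (is_max_symdiff_maximal max_m)).
rewrite (mem_maximal_symdiff_max max_m); case: eqP => // eqDE.
by case/andP: max_m; rewrite eqDE in_symdiff addbb.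
Qed.

Lemma L_of_colex D E : L_of s D E = colex s D E.
Proof.
have [-> | ] := eqVneq D E; first by rewrite /L_of /colex !eqxx.
rewrite -val_eqE -symdiff_eq0 => /(exists_max lin_s)[m max_m].
by rewrite (colex_max lin_s max_m) (L_of_max max_m).
Qed.

Lemma L_of_linear_extension : linear_extension (L_of s).
Proof.
have [refl_c anti_c trans_c total_c] := colex_linear lin_s.
split; last by move=> D E sDE; rewrite L_of_colex subset_colex.
split=> [D | D E | D E F | D E]; rewrite !L_of_colex.
- exact: refl_c.
- by move/anti_c/val_inj.
- exact: trans_c.
exact: total_c.
Qed.

End LOf.

(** * Blocks of pairs of downsets *)

Section Block.
Variables (d : Order.disp_t) (P : finPOrderType d).
Implicit Types (D E X Y : downset P) (x r : P) (I U : {set P}).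
Implicit Types (p q : downset P * downset P) (L : rel (downset P)).

Definition block I U : {set downset P * downset P} :=
  [set p : downset P * downset P | (p.1 :&: p.2 == I) && (p.1 :|: p.2 == U)].

Lemma blockP I U p :
  reflect (forall x, (x \in p.1) && (x \in p.2) = (x \in I)
                  /\ (x \in p.1) || (x \in p.2) = (x \in U))
    (p \in block I U).
Proof.
rewrite inE; apply: (iffP andP) => [[/eqP<- /eqP<-] x | eqIU].
  by rewrite !inE.
by split; apply/eqP/setP => x; rewrite !inE; case: (eqIU x).
Qed.

Lemma mem_block_self D E : (D, E) \in block (D :&: E) (D :|: E).
Proof. by rewrite inE !eqxx. Qed.

Definition swap p : downset P * downset P := (p.2, p.1).

Lemma swap_block I U p : p \in block I U -> swap p \in block I U.
Proof. by rewrite !inE /= setIC setUC. Qed.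

Lemma block_mem2 I U p x :
  p \in block I U -> x \in U :\: I -> (x \in p.2) = (x \notin p.1).
Proof.
by move=> /blockP/(_ x); rewrite inE => -[<- <-]; do 2!case: (x \in _).
Qed.

Lemma block_symdiff I U p : p \in block I U -> symdiff p.1 p.2 = U :\: I.
Proof.
move=> /blockP bp; apply/setP => x; rewrite in_symdiff inE.
by case: (bp x) => <- <-; do 2!case: (x \in _).
Qed.

Lemma block_self_symdiff D E p :
  p \in block (D :&: E) (D :|: E) -> symdiff p.1 p.2 = symdiff D E.
Proof.
by move=> bp; rewrite (block_symdiff bp) (block_symdiff (mem_block_self D E)).
Qed.

Lemma block_card I U p : p \in block I U -> (#|p.1| + #|p.2| = #|U| + #|I|)%N.
Proof. by rewrite inE => /andP[/eqP<- /eqP<-]; rewrite cardsUI. Qed.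

Lemma block_neq I U p : I != U -> p \in block I U -> p.1 != p.2.
Proof.
rewrite inE => neqIU /andP[/eqP eqI /eqP eqU]; apply: contra neqIU => /eqP eq12.
by rewrite -eqI -eqU eq12 setIid setUid.
Qed.

Lemma block_fst_inj I U : {in block I U &, injective (fun p => downset_set p.1)}.
Proof.
move=> [X Y] [X' Y'] /blockP bp /blockP bq /= /val_inj eqX; subst X'.
congr pair; apply/val_inj/setP => x.
by case: (bp x) (bq x) => /= <- <- []; do 3!case: (x \in _).
Qed.

Lemma block_half_graph I U L : linear_order L -> I != U ->
  (#|block I U :&: graph L| * 2 = #|block I U|)%N.
Proof.
move=> lin_L neqIU; apply: (card_involution_half (f := swap)) => p bp.
- exact: swap_block.
- by case: p bp.
by rewrite !inE /= (linear_neq lin_L) // eq_sym (block_neq neqIU).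
Qed.

Definition snd_containing x : {set downset P * downset P} :=
  [set p : downset P * downset P | x \in p.2].

Lemma block_half_mem I U x : x \in U :\: I ->
  (#|block I U :&: snd_containing x| * 2 = #|block I U|)%N.
Proof.
move=> UIx; apply: (card_involution_half (f := swap)) => p bp.
- exact: swap_block.
- by case: p bp.
by rewrite !inE /= (block_mem2 bp UIx) negbK.
Qed.

(* For (X, Y) and p in the same block, this exchanges the two entries of p on
   Y :\: X and keeps them on X :\: Y. *)
Definition toggle X Y p : downset P * downset P :=
  (downsetU (downsetI p.1 X) (downsetI p.2 Y),
   downsetU (downsetI p.2 X) (downsetI p.1 Y)).

Lemma toggle_block I U X Y p :
  (X, Y) \in block I U -> p \in block I U -> toggle X Y p \in block I U.
Proof.
move=> /blockP bXY /blockP bp; apply/blockP => x; rewrite !inE.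
by case: (bXY x) (bp x) => [<- <-] [] /=; do 4?case: (x \in _).
Qed.

Lemma toggleK I U X Y p :
  (X, Y) \in block I U -> p \in block I U -> toggle X Y (toggle X Y p) = p.
Proof.
case: p => D E /blockP bXY /blockP bp; congr pair; apply/val_inj/setP => x;
  by rewrite !inE; case: (bXY x) (bp x) => [<- <-] [] /=; do 4?case: (x \in _).
Qed.

Lemma block_quarter_mem I U X Y r r' :
    (X, Y) \in block I U -> r \in X :\: Y -> r' \in Y :\: X ->
  (#|block I U :&: snd_containing r :&: snd_containing r'| * 4 = #|block I U|)%N.
Proof.
move=> bXY Xr Yr'; have eqUI := block_symdiff bXY.
have UIr : r \in U :\: I by rewrite -eqUI inE Xr.
have UIr' : r' \in U :\: I by rewrite -eqUI inE Yr' orbT.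
rewrite -[4]/(2 * 2)%N mulnA -(block_half_mem UIr); congr muln.
move: Xr Yr'; rewrite !inE => /andP[/negPf nYr Xr] /andP[/negPf nXr' Yr'].
apply: (card_involution_half (f := toggle X Y)) => p /setIP[bp].
- rewrite inE => p2r; apply/setIP; split; first exact: toggle_block.
  by rewrite !inE /= p2r Xr.
- by rewrite (toggleK bXY).
by rewrite !inE /= nXr' Yr' andbF andbT (block_mem2 bp UIr') negbK.
Qed.

Definition spread_closed (F : {set downset P * downset P}) : Prop :=
  forall X Y X' Y', X' <= X -> Y <= Y' -> (X, Y) \in F -> (X', Y') \in F.

Lemma graph_spread_closed L : linear_extension L -> spread_closed (graph L).
Proof.
case=> lin_L ext_L X Y X' Y' leX leY; rewrite !inE /= => LXY.
exact: linear_trans (ext_L _ _ leX) (linear_trans lin_L LXY (ext_L _ _ leY)).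
Qed.

Lemma block_meet_join I U p q : p \in block I U -> q \in block I U ->
  (downsetI p.1 q.1, downsetU p.2 q.2) \in block I U.
Proof.
move=> /blockP bp /blockP bq; apply/blockP => x; rewrite !inE.
by case: (bp x) (bq x) => [<- <-] [] /=; do 4?case: (x \in _).
Qed.

(* The first entries of a block form a lattice of sets, in which those of a
   spread-closed family form a down-set: apply Daykin's inequality to two such
   down-sets. *)
Lemma block_correlation I U (F G : {set downset P * downset P}) :
    spread_closed F -> spread_closed G ->
  (#|block I U :&: F| * #|block I U :&: G|
   <= #|block I U| * #|block I U :&: (F :&: G)|)%N.
Proof.
move=> closedF closedG; pose fst_set p := downset_set p.1.
have card_fst (H : {set downset P * downset P}) :
    H \subset block I U -> #|H| = #|fst_set @: H|.
  move=> /subsetP sHB; rewrite card_in_imset // => p q /sHB bp /sHB bq.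
  exact: block_fst_inj bp bq.
rewrite !card_fst ?subsetIl //; apply: leq_trans (daykin_inequality _ _) _.
apply: leq_mul; apply/subset_leq_card/subsetP => _ /imset2P[_ _
  /imsetP[p /setIP[bp Fp] ->] /imsetP[q /setIP[bq Gq] ->] ->]; apply/imsetP.
  exists (swap (downsetI p.2 q.2, downsetU p.1 q.1)) => //.
  by apply/swap_block/(@block_meet_join _ _ (swap p) (swap q)); apply: swap_block.
exists (downsetI p.1 q.1, downsetU p.2 q.2) => //.
apply/setIP; split; first exact: block_meet_join.
case: p q Fp Gq {bp bq} => [X Y] [X' Y'] FXY GXY /=.
apply/setIP; split; [apply: closedF FXY | apply: closedG GXY].
- exact: subsetIl.
- exact: subsetUl.
- exact: subsetIr.
exact: subsetUr.
Qed.

Lemma block_agreement_lower I U L1 L2 :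
    linear_extension L1 -> linear_extension L2 -> I != U ->
  (#|block I U| <= #|block I U :&: (graph L1 :&: graph L2)| * 4)%N.
Proof.
move=> lext1 lext2 neqIU; have [[lin1 _] [lin2 _]] := (lext1, lext2).
have closed1 := graph_spread_closed lext1; have closed2 := graph_spread_closed lext2.
have := block_correlation I U closed1 closed2.
have := block_half_graph lin1 neqIU; have := block_half_graph lin2 neqIU.
move: #|block I U| #|_ :&: (_ :&: _)| #|_ :&: graph L1| #|_ :&: graph L2|.
by move=> b agree half1 half2; nia.
Qed.

Lemma block_reversal_agreement I U L1 L2 : linear_order L1 -> I != U ->
  ((#|block I U :&: (graph L1 :\: graph L2)| +
    #|block I U :&: (graph L1 :&: graph L2)|) * 2 = #|block I U|)%N.
Proof.
move=> lin1 neqIU.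
rewrite -(block_half_graph lin1 neqIU) -[in RHS](cardsID (graph L2)).
by rewrite setIA setIDA addnC.
Qed.

Lemma distance_sum_blocks L1 L2 : linear_order L1 -> linear_order L2 ->
  distance L1 L2 =
  (\sum_(k : {set P} * {set P}) #|block k.1 k.2 :&: (graph L1 :\: graph L2)|)%N.
Proof.
move=> lin1 lin2; rewrite distance_graph // -sum1_card.
rewrite (partition_big (fun p => (p.1 :&: p.2, p.1 :|: p.2)) predT) //=.
apply: eq_bigr => -[I U] _ /=; rewrite -sum1_card; apply: eq_bigl => p.
by rewrite [RHS]inE xpair_eqE andbC [p \in block _ _]inE.
Qed.

End Block.

(** * Realizers *)

Definition realizer (d : Order.disp_t) (P : finPOrderType d)
    (s1 s2 : rel P) : Prop :=
  [/\ linear_extension s1, linear_extension s2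
    & forall x y : P, x <= y <-> s1 x y /\ s2 x y].

Lemma realizerC (d : Order.disp_t) (P : finPOrderType d) (s1 s2 : rel P) :
  realizer s1 s2 -> realizer s2 s1.
Proof. by case=> lext1 lext2 le12; split=> // x y; rewrite le12 and_comm. Qed.

Section Realizer.
Variables (d : Order.disp_t) (P : finPOrderType d) (s1 s2 : rel P).
Hypothesis realizer_s : realizer s1 s2.
Implicit Types (D E X Y : downset P) (x y m : P).

Let lext1 : linear_extension s1. Proof. by case: realizer_s. Qed.
Let lext2 : linear_extension s2. Proof. by case: realizer_s. Qed.
Let lin1 : linear_order s1 := lext1.1.
Let lin2 : linear_order s2 := lext2.1.

Lemma realizer_le x y : s1 x y -> s2 x y -> x <= y.
Proof. by case: realizer_s => _ _ le12 s1xy s2xy; apply/le12. Qed.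

Lemma realizer_incomparable x y : x >< y -> s2 x y = ~~ s1 x y.
Proof.
move=> xy; apply/idP/idP => [s2xy | /(linearN lin1) s1yx].
  by apply: contraFN (incomparable_leF xy) => s1xy; apply: realizer_le.
apply: (linearN lin2); rewrite comparable_sym in xy.
by apply: contraFN (incomparable_leF xy); apply: realizer_le.
Qed.

Lemma realizer_separates D E m1 m2 :
    D >< E -> is_max s1 (symdiff D E) m1 -> is_max s2 (symdiff D E) m2 ->
  exists X Y, [/\ (X, Y) \in block (D :&: E) (D :|: E),
    m1 \in X :\: Y & m2 \in Y :\: X].
Proof.
wlog DEm1 : D E / m1 \in D :\: E => [sep DE max1 max2 | ].
  have /setUP[DEm1 | EDm1] := (is_maxP _ _ _ max1).1; first exact: sep.
  by rewrite setIC setUC; apply: sep; rewrite 1?comparable_sym 1?symdiffC.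
rewrite comparable_sym => /incomparable_setD[x EDx].
have /setDP[Ex nDx] := EDx; have Qx : x \in symdiff D E by rewrite inE EDx orbT.
move=> /is_maxP[_ /(_ x Qx) s1xm1] /is_maxP[Qm2 /(_ x Qx) s2xm2].
case/setUP: Qm2 => [DEm2 | EDm2]; last first.
  by exists D, E; rewrite mem_block_self.
have [/setDP[Dm1 nEm1] /setDP[Dm2 nEm2]] := (DEm1, DEm2).
have neq_x z : z \in D -> x != z by apply: contraTneq => <-.
have opposite z : z \in D :\: E -> s2 z x = ~~ s1 z x.
  by move=> DEz; apply/realizer_incomparable/(setD_incomparable DEz).
have ns1m1x : s1 m1 x = false by apply/negbTE; rewrite -(linear_neq lin1) ?neq_x.
have ns2m2x : s2 m2 x = false by apply/negbTE; rewrite -(linear_neq lin2) ?neq_x.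
(* Since s1 and s2 order x and D :\: E oppositely, the segment of s2 below x and
   the segment of s1 below x cut D :\: E into complementary parts. *)
exists (downsetI D (downsetU E (Downset (is_downset_initial x lext2)))).
exists (downsetU E (downsetI D (Downset (is_downset_initial x lext1)))).
split.
- apply/blockP => z; rewrite !inE; have := opposite z; rewrite inE.
  by case: (z \in D); case: (z \in E); case: (s1 z x) => //= -> //.
- by rewrite !inE Dm1 (negPf nEm1) ns1m1x opposite ?ns1m1x.
by rewrite !inE Dm2 (negPf nEm2) ns2m2x /= -[s1 _ _]negbK -opposite ?ns2m2x.
Qed.

Lemma realizer_diametral : diametral_pair s1 s2.
Proof.
split=> // M1 M2 [linM1 extM1] [linM2 extM2].
apply/subset_leq_card/subsetP => e; rewrite !inE.
case/existsP => x /existsP[y /and4P[/eqP-> neq_xy M1xy M2yx]].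
have xy : x >< y.
  rewrite incomparableE; apply/andP; split; apply: contra neq_xy => le_xy.
    by apply/eqP/(linear_anti linM2) => //; apply: extM2.
  by apply/eqP/(linear_anti linM1) => //; apply: extM1.
have yx : y >< x by rewrite comparable_sym.
have [s1xy | /(linearN lin1) s1yx] := boolP (s1 x y); apply/existsP.
  exists x; apply/existsP; exists y; rewrite eqxx neq_xy s1xy.
  by rewrite realizer_incomparable // -(linear_neq lin1).
exists y; apply/existsP; exists x; rewrite setUC eqxx eq_sym neq_xy s1yx.
by rewrite realizer_incomparable // -(linear_neq lin1) // eq_sym.
Qed.

End Realizer.

(** * Tight pairs of linear extensions *)

Section Tight.
Variables (d : Order.disp_t) (P : finPOrderType d).
Implicit Types (D E X Y : downset P) (I U : {set P}) (L M : rel (downset P)).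

Definition tight L1 L2 : Prop := forall D E, D >< E ->
  (#|block (D :&: E) (D :|: E) :&: (graph L1 :&: graph L2)| * 4
   <= #|block (D :&: E) (D :|: E)|)%N.

Lemma tightC L1 L2 : tight L1 L2 -> tight L2 L1.
Proof. by move=> tightL D E DE; rewrite [graph L2 :&: _]setIC tightL. Qed.

Lemma L_of_tight (s1 s2 : rel P) : realizer s1 s2 -> tight (L_of s1) (L_of s2).
Proof.
move=> rlz D E DE; have [lext1 lext2 _] := rlz.
have neqDE : symdiff D E != set0.
  by rewrite symdiff_eq0 val_eqE (incomparable_eqF DE).
have [m1 max1] := exists_max lext1.1 neqDE.
have [m2 max2] := exists_max lext2.1 neqDE.
have [X [Y [bXY Xm1 Ym2]]] := realizer_separates rlz DE max1 max2.
rewrite -(block_quarter_mem bXY Xm1 Ym2) leq_mul2r /= -setIA.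
apply/subset_leq_card/subsetP => p /setIP[bp /setIP[]]; rewrite !in_setI bp.
rewrite -(block_self_symdiff bp) in max1 max2.
rewrite ![_ \in graph _]inE ![_ \in snd_containing _]inE.
by rewrite (L_of_max lext1 max1) (L_of_max lext2 max2) => -> ->.
Qed.

Lemma incomparable_setI_neq_setU D E : D >< E -> D :&: E != D :|: E.
Proof.
case/incomparable_setD => x /setDP[Dx /negPf nEx].
by apply/eqP => /setP/(_ x); rewrite !inE Dx nEx.
Qed.

Lemma reversed_incomparable L1 L2 D E :
    linear_extension L1 -> linear_extension L2 ->
  (D, E) \in graph L1 :\: graph L2 -> D >< E.
Proof.
move=> [lin1 ext1] [lin2 ext2]; rewrite !inE /= => /andP[nL2DE L1DE].
rewrite incomparableE (contra (ext2 _ _) nL2DE) /=.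
apply: contra nL2DE => /ext1 L1ED.
by rewrite (linear_anti lin1 L1DE L1ED) (linear_refl lin2).
Qed.

Lemma tight_reversals_max L1 L2 M1 M2 I U :
    linear_extension L1 -> linear_extension L2 ->
    linear_extension M1 -> linear_extension M2 -> tight M1 M2 ->
  (#|block I U :&: (graph L1 :\: graph L2)|
   <= #|block I U :&: (graph M1 :\: graph M2)|)%N.
Proof.
move=> lextL1 lextL2 lextM1 lextM2 tightM.
have [-> | [[D E] /setIP[bDE revDE]]] :=
  set_0Vmem (block I U :&: (graph L1 :\: graph L2)); first by rewrite cards0.
have DE := reversed_incomparable lextL1 lextL2 revDE.
have := tightM D E DE; have := incomparable_setI_neq_setU DE.
move: bDE; rewrite inE => /andP[/eqP-> /eqP->] neqIU.
have := block_agreement_lower lextL1 lextL2 neqIU.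
have := block_reversal_agreement L2 lextL1.1 neqIU.
have := block_reversal_agreement M2 lextM1.1 neqIU.
lia.
Qed.

Lemma diametral_tight L1 L2 :
  two_dimensional P -> diametral_pair L1 L2 -> tight L1 L2.
Proof.
case=> s1 [s2 rlz] [lextL1 lextL2 diam] D E DE; have [lext1 lext2 _] := rlz.
have lextM1 := L_of_linear_extension lext1.
have lextM2 := L_of_linear_extension lext2.
have tightM := L_of_tight rlz.
pose rev M1 M2 (k : {set P} * {set P}) :=
  #|block k.1 k.2 :&: (graph M1 :\: graph M2)|.
have eq_rev k : rev L1 L2 k = rev (L_of s1) (L_of s2) k.
  apply/eqP; move: k; apply/forallP.
  have le_rev k : true -> (rev L1 L2 k <= rev (L_of s1) (L_of s2) k
      ?= iff (rev L1 L2 k == rev (L_of s1) (L_of s2) k))%N.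
    by move=> _; apply/leqif_eq/tight_reversals_max.
  rewrite -(leqif_sum le_rev).2 eqn_leq (leqif_sum le_rev).1 /=.
  have [linL1 linL2] := (lextL1.1, lextL2.1).
  have [linM1 linM2] := (lextM1.1, lextM2.1).
  by have := diam _ _ lextM1 lextM2; rewrite !distance_sum_blocks.
have neqIU := incomparable_setI_neq_setU DE.
have := block_reversal_agreement L2 lextL1.1 neqIU.
have := block_reversal_agreement (L_of s2) lextM1.1 neqIU.
have := tightM D E DE; have := eq_rev (D :&: E, D :|: E); rewrite /rev /=; lia.
Qed.

End Tight.

(** * Tight pairs are pairs of orders L_s *)

Lemma principal_order_linear_extension (d : Order.disp_t) (P : finPOrderType d)
    (L : rel (downset P)) :
  linear_extension L -> linear_extension (principal_order L).
Proof.
case=> lin_L ext_L; split; last first.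
  by move=> x y le_xy; apply/ext_L/principal_subset; rewrite inE.
split=> [x | x y /andP[Lxy Lyx] | y x z | x y].
- exact: (linear_refl lin_L).
- have /(congr1 (@downset_set _ _))/setP eq_xy := linear_anti lin_L Lxy Lyx.
  by apply: le_anti; move: (eq_xy x) (eq_xy y); rewrite !inE !lexx => <- ->.
- exact: (linear_trans lin_L).
exact: (linear_total lin_L).
Qed.

Section TightDisagreement.
Variables (d : Order.disp_t) (P : finPOrderType d) (L1 L2 : rel (downset P)).
Hypotheses (lext1 : linear_extension L1) (lext2 : linear_extension L2).
Hypothesis tightL : tight L1 L2.
Implicit Types (D E X Y : downset P) (x y r : P).

(* The pairs (X, Y) with r and r' in Y are a quarter of the block, at least as
   many as there are agreements; so no other pair is an agreement. *)
Lemma tight_disagreement D E r r' :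
    r \in D :\: E -> r' \in E :\: D ->
    (forall X Y, (X, Y) \in block (D :&: E) (D :|: E) -> r \in Y -> r' \in Y ->
       L1 X Y && L2 X Y) ->
  L1 D E -> ~~ L2 D E.
Proof.
move=> Dr Er' agree L1DE; apply/negP => L2DE.
have DE : D >< E.
  case/setDP: Dr Er' => Dr nEr /setDP[Er' nDr'].
  rewrite incomparableE; apply/andP.
  by split; apply/subsetPn; [exists r | exists r'].
have := tightL DE; rewrite leqNgt => /negP[].
rewrite -(block_quarter_mem (mem_block_self D E) Dr Er') ltn_mul2r /=.
apply/proper_card/properP; split.
  apply/subsetP => -[X Y] /setIP[/setIP[bXY]].
  rewrite ![_ \in snd_containing _]inE => Yr Yr'.
  rewrite in_setI bXY in_setI [_ \in graph L1]inE [_ \in graph L2]inE.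
  exact: agree.
exists (D, E); first by rewrite in_setI mem_block_self in_setI !inE L1DE.
by rewrite !inE /= (negPf (setDP Dr).2) andbF.
Qed.

Lemma tight_principal_realizer :
  realizer (principal_order L1) (principal_order L2).
Proof.
have lext_s1 := principal_order_linear_extension lext1.
have lext_s2 := principal_order_linear_extension lext2.
split=> // x y; split=> [le_xy | [s1xy s2xy]].
  by rewrite lext_s1.2 ?lext_s2.2.
apply: contraT => nxy; have [le_yx | nyx] := boolP (y <= x).
  by rewrite (linear_anti lext_s1.1 s1xy (lext_s1.2 _ _ le_yx)) lexx in nxy.
have xDy : x \in principal x :\: principal y by rewrite !inE lexx nxy.
have yDx : y \in principal y :\: principal x by rewrite !inE lexx nyx.
have agree X Y :
    (X, Y) \in block (principal x :&: principal y) (principal x :|: principal y) ->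
    x \in Y -> y \in Y -> L1 X Y && L2 X Y.
  move=> /blockP bXY Yx Yy; suff le_XY : X <= Y by rewrite lext1.2 ?lext2.2.
  apply/subsetP => z Xz; case: (bXY z); rewrite Xz !inE => _ /esym/orP[] le_z.
    exact: downset_closed le_z Yx.
  exact: downset_closed le_z Yy.
by case/negP: (tight_disagreement xDy yDx agree s1xy).
Qed.

End TightDisagreement.

Definition L_of_sub_below (d : Order.disp_t) (P : finPOrderType d) (s : rel P)
    (L : rel (downset P)) (n : nat) : Prop :=
  forall D E : downset P, (#|D| + #|E| < n)%N -> L_of s D E -> L D E.

Section Below.
Variables (d : Order.disp_t) (P : finPOrderType d).
Variables (s : rel P) (L : rel (downset P)) (n : nat).
Hypotheses (lext_s : linear_extension s) (lext_L : linear_extension L).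
Hypothesis below_n : L_of_sub_below s L n.
Implicit Types (D E : downset P) (m z : P).

Lemma L_of_sub_below_removal D E m z :
    (#|D| + #|E| <= n)%N -> is_max s (symdiff D E) m -> m \in E ->
    z \in maximal_elements E -> z != m -> (z \in D -> s z m) ->
  L D E.
Proof.
move=> le_n max_m Em Mz neq_zm szm; pose E' := Downset (is_downsetD1 Mz).
have le_E'E : E' <= E by apply: subD1set.
have Ez := subsetP (maximal_elements_subset E) z Mz.
apply: (linear_trans lext_L.1 _ (lext_L.2 _ _ le_E'E)); apply: below_n.
  by move: le_n; rewrite (cardsD1 z E) Ez addnCA add1n.
have E'm : m \in E' by rewrite !inE eq_sym neq_zm.
rewrite (L_of_max lext_s (m := m)) //.
have [_ le_m] := is_maxP _ _ _ max_m.
apply/is_maxP; split=> [|w].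
  by rewrite in_symdiff E'm addbT (symdiff_max_mem max_m) Em.
have [-> | neq_wz] := eqVneq w z; rewrite in_symdiff !inE.
  by rewrite eqxx addbF.
by rewrite neq_wz => Qw; apply: le_m; rewrite in_symdiff.
Qed.

Lemma L_of_sub_below_common_max (t : rel P) D E m m' :
    linear_extension t -> (#|D| + #|E| <= n)%N ->
    is_max s (symdiff D E) m -> is_max t (symdiff D E) m' -> m' != m ->
    m \in E -> m' \in E ->
  L D E.
Proof.
move=> lext_t le_n max_m max_m' neq_m Em Em'.
apply: (L_of_sub_below_removal le_n max_m Em _ neq_m).
  exact: symdiff_max_maximal max_m' Em'.
by rewrite (symdiff_max_mem max_m') Em'.
Qed.

End Below.

Section Crossing.
Variables (d : Order.disp_t) (P : finPOrderType d).
Implicit Types (s : rel P) (D E : downset P) (x y z m : P).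

(* A maximal z != m1 of D lies below some maximal y of E. Here y = m2 would give
   z <= m1 in s1; otherwise y is in D, so y = z, and then z <= m1 <= m2 in s2. *)
Lemma crossing_principal s1 s2 D E m1 m2 :
    realizer s1 s2 ->
    is_max s1 (symdiff D E) m1 -> m1 \in D ->
    is_max s2 (symdiff D E) m2 -> m2 \in E ->
    (forall z, z \in maximal_elements D -> z != m1 -> (z \in E) && ~~ s1 z m1) ->
    (forall z, z \in maximal_elements E -> z != m2 -> (z \in D) && ~~ s2 z m2) ->
  D = principal m1.
Proof.
move=> rlz max1 Dm1 max2 Em2 maxD maxE.
have [[lin1 ext1] [lin2 ext2] _] := rlz.
have [[Qm1 le_m1] [Qm2 le_m2]] := (is_maxP _ _ _ max1, is_maxP _ _ _ max2).
suff only_m1 z : z \in maximal_elements D -> z = m1.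
  apply/eqP; rewrite eq_le principal_subset // andbT; apply/subsetP => x Dx.
  by have [z Mz le_xz] := exists_maximal Dx; rewrite inE -(only_m1 z Mz).
move=> Mz; apply/eqP; apply: contraT => neq_zm1.
have /andP[Ez ns1zm1] := maxD z Mz neq_zm1.
have [y My le_zy] := exists_maximal Ez.
have [eq_ym2 | neq_ym2] := eqVneq y m2.
  rewrite eq_ym2 in le_zy.
  by rewrite (linear_trans lin1 (ext1 _ _ le_zy)) ?le_m1 in ns1zm1.
have /andP[Dy ns2ym2] := maxE y My neq_ym2.
rewrite (maximal_eq Mz Dy le_zy) in ns2ym2.
have Mm1 : m1 \in maximal_elements D.
  by rewrite symdiffC in max1; apply: symdiff_max_maximal max1 Dm1.
have s2zm1 : s2 z m1.
  by rewrite (realizer_incomparable rlz) // (maximal_incomparable Mz Mm1).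
by rewrite (linear_trans lin2 s2zm1) ?le_m2 in ns2ym2.
Qed.

Lemma realizer_max_neq s1 s2 D E m1 m2 :
    realizer s1 s2 -> D >< E ->
    is_max s1 (symdiff D E) m1 -> is_max s2 (symdiff D E) m2 ->
  m1 != m2.
Proof.
move=> rlz DE max1 max2.
have [X [Y [_ /setDP[_ nYm1] /setDP[Ym2 _]]]] :=
  realizer_separates rlz DE max1 max2.
by apply: contraTneq Ym2 => <-.
Qed.

End Crossing.

Section Step.
Variables (d : Order.disp_t) (P : finPOrderType d) (L1 L2 : rel (downset P)).
Hypotheses (lext1 : linear_extension L1) (lext2 : linear_extension L2).
Hypothesis tightL : tight L1 L2.
Implicit Types (D E X Y : downset P) (m z : P).

Let s1 := principal_order L1.
Let s2 := principal_order L2.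
Let lext_s1 : linear_extension s1 := principal_order_linear_extension lext1.
Let lext_s2 : linear_extension s2 := principal_order_linear_extension lext2.
Let rlz : realizer s1 s2 := tight_principal_realizer lext1 lext2 tightL.

Variable n : nat.
Hypotheses (below1 : L_of_sub_below s1 L1 n) (below2 : L_of_sub_below s2 L2 n).

Lemma no_crossing D E m1 m2 : (#|D| + #|E| <= n)%N ->
    is_max s1 (symdiff D E) m1 -> m1 \in E ->
    is_max s2 (symdiff D E) m2 -> m2 \in D ->
  L1 D E || L2 E D.
Proof.
move=> le_n max1 Em1 max2 Dm2; apply: contraT.
rewrite negb_or => /andP[nL1DE nL2ED].
have maxE z : z \in maximal_elements E -> z != m1 -> (z \in D) && ~~ s1 z m1.
  move=> Mz neq_z; apply: contraR nL1DE; rewrite negb_and negbK => out.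
  apply: (L_of_sub_below_removal lext_s1 lext1 below1 le_n max1 Em1 Mz neq_z) => Dz.
  by rewrite Dz in out.
rewrite symdiffC in max1 max2; rewrite addnC in le_n.
have maxD z : z \in maximal_elements D -> z != m2 -> (z \in E) && ~~ s2 z m2.
  move=> Mz neq_z; apply: contraR nL2ED; rewrite negb_and negbK => out.
  apply: (L_of_sub_below_removal lext_s2 lext2 below2 le_n max2 Dm2 Mz neq_z) => Ez.
  by rewrite Ez in out.
have eqE := crossing_principal rlz max1 Em1 max2 Dm2 maxE maxD.
rewrite symdiffC in max1 max2.
have eqD := crossing_principal (realizerC rlz) max2 Dm2 max1 Em1 maxD maxE.
have [[_ le_m1] [Qm2 _]] := (is_maxP _ _ _ max1, is_maxP _ _ _ max2).
by have := le_m1 m2 Qm2; rewrite /s1 /principal_order -eqD -eqE (negPf nL1DE).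
Qed.

Lemma block_agreement_below D E m1 m2 X Y : (#|D| + #|E| <= n)%N ->
    is_max s1 (symdiff D E) m1 -> is_max s2 (symdiff D E) m2 -> m1 != m2 ->
    (X, Y) \in block (D :&: E) (D :|: E) -> m1 \in Y -> m2 \in Y ->
  L1 X Y && L2 X Y.
Proof.
move=> le_n max1 max2 neq_m bXY Ym1 Ym2.
have le_nXY : (#|X| + #|Y| <= n)%N.
  by rewrite (block_card bXY) -(block_card (mem_block_self D E)).
rewrite -(block_self_symdiff bXY) in max1 max2; apply/andP; split.
  apply: (L_of_sub_below_common_max lext_s1 lext1 below1 lext_s2 _ max1 max2) => //.
  by rewrite eq_sym.
by apply: (L_of_sub_below_common_max lext_s2 lext2 below2 lext_s1 _ max2 max1).
Qed.

Lemma L_of_sub_step : L_of_sub_below s1 L1 n.+1.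
Proof.
move=> D E; rewrite ltnS => le_n LsDE; apply: contraT => nL1DE.
have neqDE : symdiff D E != set0.
  rewrite symdiff_eq0 val_eqE; apply: contra nL1DE => /eqP->.
  exact: linear_refl lext1.1 _.
have [m1 max1] := exists_max lext_s1.1 neqDE.
have [m2 max2] := exists_max lext_s2.1 neqDE.
have Em1 : m1 \in E by rewrite -(L_of_max lext_s1 max1).
have nDm1 : m1 \notin D by rewrite (symdiff_max_mem max1) Em1.
have DE : D >< E.
  rewrite incomparableE (contra (lext1.2 _ _) nL1DE) /=.
  by apply/subsetPn; exists m1.
have neq_m := realizer_max_neq rlz DE max1 max2.
have agree X Y := block_agreement_below (X := X) (Y := Y) le_n max1 max2 neq_m.
have nEm2 : m2 \notin E.
  apply: contra nL1DE => Em2.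
  by have /andP[] := agree D E (mem_block_self D E) Em1 Em2.
have Dm2 : m2 \in D by rewrite (symdiff_max_mem max2).
have L2ED : L2 E D.
  by have := no_crossing le_n max1 Em1 max2 Dm2; rewrite (negPf nL1DE).
have L1ED := linearN lext1.1 nL1DE.
have Em1D : m1 \in E :\: D by rewrite inE nDm1.
have Dm2E : m2 \in D :\: E by rewrite inE nEm2.
rewrite setIC setUC in agree.
by rewrite (negPf (tight_disagreement tightL Em1D Dm2E agree L1ED)) in L2ED.
Qed.

End Step.

Section TightLOf.
Variables (d : Order.disp_t) (P : finPOrderType d).
Implicit Types (L : rel (downset P)) (n : nat).

Lemma tight_L_of_sub_below L1 L2 n :
    linear_extension L1 -> linear_extension L2 -> tight L1 L2 ->
  L_of_sub_below (principal_order L1) L1 n /\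
  L_of_sub_below (principal_order L2) L2 n.
Proof.
move=> lext1 lext2 tightL; elim: n => [|n [below1 below2]]; first by split.
split; first exact: (L_of_sub_step lext1 lext2).
by apply: (L_of_sub_step lext2 lext1) => //; apply: tightC.
Qed.

Lemma tight_L_of L1 L2 :
    linear_extension L1 -> linear_extension L2 -> tight L1 L2 ->
  L1 =2 L_of (principal_order L1).
Proof.
move=> lext1 lext2 tightL D E; symmetry; move: D E.
have lext_Ls := L_of_linear_extension (principal_order_linear_extension lext1).
apply: (linear_subrel_eq lext_Ls.1 lext1.1) => D E.
by apply: (tight_L_of_sub_below _ lext1 lext2 tightL).1.
Qed.

End TightLOf.

Theorem theorem5 (d : Order.disp_t) (P : finPOrderType d)
    (L Lbar : rel (downset P)) :
  two_dimensional P ->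
  diametral_pair L Lbar ->
  let sigma := principal_order L in
  exists sigmabar : rel P,
    [/\ diametral_pair sigma sigmabar,
        L =2 L_of sigma
      & Lbar =2 L_of sigmabar].
Proof.
move=> dimP diam sigma; have tightL := diametral_tight dimP diam.
have [lextL lextLbar _] := diam; exists (principal_order Lbar); split.
- exact/realizer_diametral/tight_principal_realizer.
- exact: tight_L_of lextL lextLbar tightL.
exact: tight_L_of lextLbar lextL (tightC tightL).
Qed.
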